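(* Let $[\sigma,\rho]_L$ be an interval in left weak Bruhat order on $\mathfrak{S}_n$. Let $D$ (a diagram of $n$ boxes with a reading order) and $\mathrm{StdTab}(D)\subseteq\mathrm{StdFill}(D)$ be chosen such that $\{\mathrm{rw}(T):T\in\mathrm{StdTab}(D)\}$ is equal to $[\sigma,\rho]_L$. Then the weak Bruhat interval module $\overline{B}(\sigma,\rho)$ is isomorphic, as an $H_n(0)$-module, to $\mathbf{N}_{\mathrm{StdTab}(D)}$.
   Context: $H_n(0)$ is the $\mathbb{C}$-algebra with generators $\pi_1,\dots,\pi_{n-1}$ and relations $\pi_i^2=-\pi_i$, $\pi_i\pi_j=\pi_j\pi_i$ for $|i-j|\ge2$, $\pi_i\pi_{i+1}\pi_i=\pi_{i+1}\pi_i\pi_{i+1}$. For $\gamma\in\mathfrak{S}_n$, $\mathrm{Des}(\gamma)$ is the set of $i\in\{1,\dots,n-1\}$ such that $i$ is to the right of $i+1$ in the one-line notation of $\gamma$; $s_i\gamma$ is obtained by exchanging $i$ and $i+1$ in the one-line notation of $\gamma$. The left weak Bruhat order $\preceq_L$ on $\mathfrak{S}_n$ has covering relations: $\delta$ covers $\gamma$ iff $\delta=s_i\gamma$ for some $i\notin\mathrm{Des}(\gamma)$. For $\sigma\preceq_L\rho$, $[\sigma,\rho]_L=\{\gamma:\sigma\preceq_L\gamma\preceq_L\rho\}$. The $H_n(0)$-module $\overline{B}(\sigma,\rho)$ (Jung, Kim, Lee, Oh) is the $\mathbb{C}$-span of $[\sigma,\rho]_L$ with $\pi_i\gamma=-\gamma$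 if $i\in\mathrm{Des}(\gamma)$; $\pi_i\gamma=0$ if $i\notin\mathrm{Des}(\gamma)$ and $s_i\gamma\notin[\sigma,\rho]_L$; $\pi_i\gamma=s_i\gamma$ if $i\notin\mathrm{Des}(\gamma)$ and $s_i\gamma\in[\sigma,\rho]_L$. Diagram modules. $\mathrm{StdFill}(D)$ is the set of standard fillings of $D$ (bijective assignments of $1,\dots,n$ to the boxes). A reading order is a total order on the boxes; $\mathrm{rw}(T)$ is the permutation (in one-line notation) given by the entries of $T$ in reading order from left to right. $s_iT$ exchanges the entries $i,i+1$ of $T$. For nonempty $\mathrm{StdTab}(D)\subseteq\mathrm{StdFill}(D)$ and $T\in\mathrm{StdTab}(D)$, $\mathrm{Des}(T)$ is the set of $i\in\{1,\dots,n-1\}$ with $i$ to the right of $i+1$ in $\mathrm{rw}(T)$. Elements of $\{1,\dots,n-1\}\setminus\mathrm{Des}(T)$ are ascents; an ascent $i$ is attacking if $s_iT\notin\mathrm{StdTab}(D)$ and nonattacking otherwise. $T$ has an ascent in positions $(r,s)$ if $r<s$ and $\mathrm{rw}(T)_s-\mathrm{rw}(T)_r=1$. $\mathrm{StdTab}(D)$ is ascent-compatible if whenever $T,T'\in\mathrm{StdTab}(D)$ both have an ascent in positions $(r,s)$, it is attacking in $T$ if and only if it is attacking in $T'$. In that case $\mathbf{N}_{\mathrm{StdTab}(D)}$ is the $H_n(0)$-module on the $\mathbb{C}$-span of $\mathrm{StdTab}(D)$ with $\pi_iT=-T$ if $i\in\mathrm{Des}(T)$, $0$ if $i$ is an attacking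 ascent, $s_iT$ if $i$ is a nonattacking ascent. *)

(* Defs.v *)
From HB Require Import structures.
From mathcomp Require Import all_boot all_order all_fingroup all_algebra.
From mathcomp Require Import boolp zify generic_quotient.

Set Implicit Arguments.
Unset Strict Implicit.
Unset Printing Implicit Defensive.

Import GRing.Theory.
Local Open Scope ring_scope.
Local Open Scope quotient_scope.

(* Indices are shifted by one: 'I_n is {1, ..., n} and 'I_n.-1 is
   {1, ..., n-1}, with i : 'I_n.-1 standing for the number i + 1. *)

(* The 0-Hecke algebra is presented by generators and relations: formal
   expressions modulo the least congruence that contains the axioms of
   K-algebras and the defining relations. *)

Inductive hecke_term (K : fieldType) (n : nat) : Type :=
| HGen of 'I_n.-1
| HZero
| HOne
| HAdd of hecke_term K n & hecke_term K n
| HScale of K & hecke_term K n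
| HMul of hecke_term K n & hecke_term K n.
Arguments HGen {K n}.
Arguments HZero {K n}.
Arguments HOne {K n}.

HB.instance Definition _ K n := gen_eqMixin (hecke_term K n).
HB.instance Definition _ K n := gen_choiceMixin (hecke_term K n).

Inductive hecke_cong (K : fieldType) (n : nat) :
  hecke_term K n -> hecke_term K n -> Prop :=
| hc_refl t : hecke_cong t t
| hc_sym t u : hecke_cong t u -> hecke_cong u t
| hc_trans t u v : hecke_cong t u -> hecke_cong u v -> hecke_cong t v
| hc_add t t' u u' : hecke_cong t t' -> hecke_cong u u' ->
    hecke_cong (HAdd t u) (HAdd t' u')
| hc_scale a t t' : hecke_cong t t' -> hecke_cong (HScale a t) (HScale a t')
| hc_mul t t' u u' : hecke_cong t t' -> hecke_cong u u' ->
    hecke_cong (HMul t u) (HMul t' u')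
| hc_addA t u v : hecke_cong (HAdd t (HAdd u v)) (HAdd (HAdd t u) v)
| hc_addC t u : hecke_cong (HAdd t u) (HAdd u t)
| hc_add0 t : hecke_cong (HAdd HZero t) t
| hc_addN t : hecke_cong (HAdd (HScale (-1) t) t) HZero
| hc_scaleA a b t : hecke_cong (HScale a (HScale b t)) (HScale (a * b) t)
| hc_scale1 t : hecke_cong (HScale 1 t) t
| hc_scaleDr a t u :
    hecke_cong (HScale a (HAdd t u)) (HAdd (HScale a t) (HScale a u))
| hc_scaleDl a b t :
    hecke_cong (HScale (a + b) t) (HAdd (HScale a t) (HScale b t))
| hc_mulA t u v : hecke_cong (HMul t (HMul u v)) (HMul (HMul t u) v)
| hc_mul1l t : hecke_cong (HMul HOne t) t
| hc_mul1r t : hecke_cong (HMul t HOne) t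
| hc_mulDl t u v : hecke_cong (HMul (HAdd t u) v) (HAdd (HMul t v) (HMul u v))
| hc_mulDr t u v : hecke_cong (HMul t (HAdd u v)) (HAdd (HMul t u) (HMul t v))
| hc_scaleAl a t u : hecke_cong (HScale a (HMul t u)) (HMul (HScale a t) u)
| hc_scaleAr a t u : hecke_cong (HScale a (HMul t u)) (HMul t (HScale a u))
| hc_quad (i : 'I_n.-1) :
    hecke_cong (HMul (HGen i) (HGen i)) (HScale (-1) (HGen i))
| hc_comm (i j : 'I_n.-1) : (i.+2 <= j)%N || (j.+2 <= i)%N ->
    hecke_cong (HMul (HGen i) (HGen j)) (HMul (HGen j) (HGen i))
| hc_braid (i j : 'I_n.-1) : j = i.+1 :> nat ->
    hecke_cong (HMul (HGen i) (HMul (HGen j) (HGen i)))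
               (HMul (HGen j) (HMul (HGen i) (HGen j))).

Section HeckeRelations.
Variables (K : fieldType) (n : nat) (V : lmodType K).

Definition hecke_relations (f : 'I_n.-1 -> {linear V -> V}) : Prop :=
  [/\ forall i v, f i (f i v) = - f i v,
      forall i j : 'I_n.-1, (i.+2 <= j)%N || (j.+2 <= i)%N ->
        forall v, f i (f j v) = f j (f i v)
    & forall i j : 'I_n.-1, j = i.+1 :> nat ->
        forall v, f i (f j (f i v)) = f j (f i (f j v))].

Variable f : 'I_n.-1 -> {linear V -> V}.

Fixpoint hecke_eval (t : hecke_term K n) (v : V) : V :=
  match t with
  | HGen i => f i v
  | HZero => 0
  | HOne => v
  | HAdd t u => hecke_eval t v + hecke_eval u v
  | HScale a t => a *: hecke_eval t v
  | HMul t u => hecke_eval t (hecke_eval u v)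
  end.

Fact hecke_eval_linear t : linear (hecke_eval t).
Proof.
elim: t => [i|||t IHt u IHu|a t IHt|t IHt u IHu] b v w //=.
- by rewrite linearP.
- by rewrite scaler0 addr0.
- by rewrite IHt IHu scalerDr addrACA.
- by rewrite IHt scalerDr !scalerA [a * b]mulrC.
- by rewrite IHu IHt.
Qed.

Lemma hecke_evalD t v w :
  hecke_eval t (v + w) = hecke_eval t v + hecke_eval t w.
Proof. by have := hecke_eval_linear t 1 v w; rewrite !scale1r. Qed.

Lemma hecke_eval0 t : hecke_eval t 0 = 0.
Proof. by apply: (addrI (hecke_eval t 0)); rewrite -hecke_evalD !addr0. Qed.

Lemma hecke_evalZ t a v : hecke_eval t (a *: v) = a *: hecke_eval t v.
Proof.
by have := hecke_eval_linear t a v 0; rewrite !addr0 hecke_eval0 addr0.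
Qed.

Hypothesis f_rel : hecke_relations f.

Lemma hecke_eval_cong t u : hecke_cong t u -> hecke_eval t =1 hecke_eval u.
Proof.
have [fQ fC fB] := f_rel.
elim=> {t u} //=.
- by move=> t u _ IH v; rewrite IH.
- by move=> t u w _ IH1 _ IH2 v; rewrite IH1 IH2.
- by move=> t t' u u' _ IH1 _ IH2 v; rewrite IH1 IH2.
- by move=> a t t' _ IH v; rewrite IH.
- by move=> t t' u u' _ IH1 _ IH2 v; rewrite IH2 IH1.
- by move=> t u w v; rewrite addrA.
- by move=> t u v; rewrite addrC.
- by move=> t v; rewrite add0r.
- by move=> t v; rewrite scaleN1r addNr.
- by move=> a b t v; rewrite scalerA.
- by move=> t v; rewrite scale1r.
- by move=> a t u v; rewrite scalerDr.
- by move=> a b t v; rewrite scalerDl.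
- by move=> t u w v; rewrite hecke_evalD.
- by move=> a t u v; rewrite hecke_evalZ.
- by move=> i v; rewrite scaleN1r fQ.
Qed.

End HeckeRelations.

Section HeckeAlgebra.
Variables (K : fieldType) (n : nat).
Local Notation term := (hecke_term K n).
Local Notation cong := (@hecke_cong K n).

Definition hecke_congb : rel term := fun t u => `[< cong t u >].

Lemma hecke_congb_equiv : equiv_class_of hecke_congb.
Proof.
split.
- by move=> t; apply/asboolP; apply: hc_refl.
- by move=> t u; apply/asboolP/asboolP; apply: hc_sym.
- move=> u t v /asboolP tu /asboolP uv; apply/asboolP.
  exact: hc_trans tu uv.
Qed.

Canonical hecke_congb_equivRel := EquivRelPack hecke_congb_equiv.

Definition hecke0 : Type := {eq_quot hecke_congb_equivRel}.
HB.instance Definition _ := Choice.on hecke0.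
HB.instance Definition _ := EqQuotient.on hecke0.

Definition hpi_class (t : term) : hecke0 := \pi_hecke0 t.

Lemma hpi_eq (t u : term) : (hpi_class t = hpi_class u) <-> cong t u.
Proof.
split; first by move=> /eqP; rewrite /hpi_class eqmodE => /asboolP.
by move=> tu; apply/eqP; rewrite /hpi_class eqmodE; apply/asboolP.
Qed.

Lemma hpi_reprK (x : hecke0) : hpi_class (repr x) = x.
Proof. exact: reprK. Qed.

Lemma hpi_repr (t : term) : cong (repr (hpi_class t)) t.
Proof. by apply/hpi_eq; rewrite hpi_reprK. Qed.

Definition hecke_zero : hecke0 := hpi_class HZero.
Definition hecke_one : hecke0 := hpi_class HOne.
Definition hecke_add (x y : hecke0) : hecke0 :=
  hpi_class (HAdd (repr x) (repr y)).
Definition hecke_scale (a : K) (x : hecke0) : hecke0 :=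
  hpi_class (HScale a (repr x)).
Definition hecke_opp (x : hecke0) : hecke0 := hecke_scale (-1) x.
Definition hecke_mul (x y : hecke0) : hecke0 :=
  hpi_class (HMul (repr x) (repr y)).

Lemma hecke_addE t u :
  hecke_add (hpi_class t) (hpi_class u) = hpi_class (HAdd t u).
Proof. by apply/hpi_eq; apply: hc_add; apply: hpi_repr. Qed.

Lemma hecke_scaleE a t :
  hecke_scale a (hpi_class t) = hpi_class (HScale a t).
Proof. by apply/hpi_eq; apply: hc_scale; apply: hpi_repr. Qed.

Lemma hecke_mulE t u :
  hecke_mul (hpi_class t) (hpi_class u) = hpi_class (HMul t u).
Proof. by apply/hpi_eq; apply: hc_mul; apply: hpi_repr. Qed.

Let hE := (hecke_addE, hecke_scaleE, hecke_mulE).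

Lemma hecke_ind (P : hecke0 -> Prop) :
  (forall t, P (hpi_class t)) -> forall x, P x.
Proof. by move=> HP x; rewrite -(hpi_reprK x). Qed.

Ltac hecke_law c :=
  repeat (let t := fresh in elim/hecke_ind => t);
  rewrite /hecke_opp /hecke_zero /hecke_one !hE; apply/hpi_eq; apply: c.

Fact hecke_addA : associative hecke_add. Proof. hecke_law hc_addA. Qed.
Fact hecke_addC : commutative hecke_add. Proof. hecke_law hc_addC. Qed.
Fact hecke_add0 : left_id hecke_zero hecke_add. Proof. hecke_law hc_add0. Qed.
Fact hecke_addN : left_inverse hecke_zero hecke_opp hecke_add.
Proof. hecke_law hc_addN. Qed.

HB.instance Definition _ := GRing.isZmodule.Build hecke0
  hecke_addA hecke_addC hecke_add0 hecke_addN.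

Fact hecke_mulA : associative hecke_mul. Proof. hecke_law hc_mulA. Qed.
Fact hecke_mul1l : left_id hecke_one hecke_mul. Proof. hecke_law hc_mul1l. Qed.
Fact hecke_mul1r : right_id hecke_one hecke_mul.
Proof. hecke_law hc_mul1r. Qed.
Fact hecke_mulDl : left_distributive hecke_mul +%R.
Proof. rewrite /GRing.add /=; hecke_law hc_mulDl. Qed.
Fact hecke_mulDr : right_distributive hecke_mul +%R.
Proof. rewrite /GRing.add /=; hecke_law hc_mulDr. Qed.

HB.instance Definition _ := GRing.Zmodule_isPzRing.Build hecke0
  hecke_mulA hecke_mul1l hecke_mul1r hecke_mulDl hecke_mulDr.

Fact hecke_scaleA a b x :
  hecke_scale a (hecke_scale b x) = hecke_scale (a * b) x.
Proof. move: x; hecke_law hc_scaleA. Qed.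
Fact hecke_scale1 : left_id 1 hecke_scale. Proof. hecke_law hc_scale1. Qed.
Fact hecke_scaleDr : right_distributive hecke_scale +%R.
Proof. rewrite /GRing.add /= => a; hecke_law hc_scaleDr. Qed.
Fact hecke_scaleDl x : {morph hecke_scale^~ x : a b / a + b}.
Proof.
move=> a b; rewrite {2}/GRing.add /=; move: x.
hecke_law hc_scaleDl.
Qed.

Fact hecke_one_neq0 : hecke_one != 0 :> hecke0.
Proof.
apply/eqP => /hpi_eq h.
have rel0 : @hecke_relations K n K^o (fun _ => \0).
  by split=> *; rewrite /= ?oppr0.
by have /eqP := hecke_eval_cong rel0 h 1; rewrite /= oner_eq0.
Qed.

HB.instance Definition _ :=
  GRing.PzSemiRing_isNonZero.Build hecke0 hecke_one_neq0.

HB.instance Definition _ := GRing.Zmodule_isLmodule.Build K hecke0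
  hecke_scaleA hecke_scale1 hecke_scaleDr hecke_scaleDl.

Fact hecke_scaleAl a (x y : hecke0) : a *: (x * y) = (a *: x) * y.
Proof.
rewrite /GRing.mul /GRing.scale /=; move: x y; hecke_law hc_scaleAl.
Qed.
Fact hecke_scaleAr a (x y : hecke0) : a *: (x * y) = x * (a *: y).
Proof.
rewrite /GRing.mul /GRing.scale /=; move: x y; hecke_law hc_scaleAr.
Qed.

HB.instance Definition _ :=
  GRing.Lmodule_isLalgebra.Build K hecke0 hecke_scaleAl.
HB.instance Definition _ :=
  GRing.Lalgebra_isAlgebra.Build K hecke0 hecke_scaleAr.

Definition hecke_pi (i : 'I_n.-1) : hecke0 := hpi_class (HGen i).

End HeckeAlgebra.

Section HeckeModule.
Variables (K : fieldType) (n : nat) (V : lmodType K).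
Variables (f : 'I_n.-1 -> {linear V -> V}) (f_rel : hecke_relations f).

Definition hecke_module of hecke_relations f : Type := V.

Local Notation M := (hecke_module f_rel).
Local Notation H := (hecke0 K n).

HB.instance Definition _ := GRing.Zmodule.copy M V.

Definition hecke_act (h : H) (v : M) : M := hecke_eval f (repr h) v.

Lemma hecke_actE t (v : M) :
  hecke_act (hpi_class t) v = hecke_eval f t v.
Proof. exact: (hecke_eval_cong f_rel (hpi_repr t)). Qed.

Fact hecke_actA (a b : H) (v : M) :
  hecke_act a (hecke_act b v) = hecke_act (a * b) v.
Proof.
elim/hecke_ind: a => t; elim/hecke_ind: b => u.
by rewrite /GRing.mul /= hecke_mulE !hecke_actE.
Qed.

Fact hecke_act1 : left_id 1 hecke_act.
Proof. by move=> v; rewrite /GRing.one /= hecke_actE. Qed.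

Fact hecke_actDr : right_distributive hecke_act +%R.
Proof. by move=> a v w; apply: hecke_evalD. Qed.

Fact hecke_actDl (v : M) : {morph hecke_act^~ v : a b / a + b}.
Proof.
move=> a b; elim/hecke_ind: a => t; elim/hecke_ind: b => u.
by rewrite [in LHS]/GRing.add /= hecke_addE !hecke_actE.
Qed.

HB.instance Definition _ := GRing.Zmodule_isLmodule.Build H M
  hecke_actA hecke_act1 hecke_actDr hecke_actDl.

Lemma hecke_piE (i : 'I_n.-1) (v : M) : hecke_pi K i *: v = f i v.
Proof. exact: hecke_actE. Qed.

End HeckeModule.

Definition module_isomorphic (A : pzRingType) (M N : lmodType A) : Prop :=
  exists phi : {linear M -> N}, bijective phi.

Section WeakOrder.
Variable n : nat.

Definition entry (i : 'I_n.-1) : 'I_n := widen_ord (leq_pred n) i.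

Fact entry_succ_subproof (i : 'I_n.-1) : (i.+1 < n)%N.
Proof. by have := ltn_ord i; lia. Qed.

Definition entry_succ (i : 'I_n.-1) : 'I_n := Ordinal (entry_succ_subproof i).

(* The one-line notation of g is g 0, g 1, ..., so (g^-1) k is the position of
   the entry k. *)
Definition perm_des (g : 'S_n) : {set 'I_n.-1} :=
  [set i | ((g^-1)%g (entry_succ i) < (g^-1)%g (entry i))%N].

(* In MathComp (g * t) k = t (g k): this exchanges values, not positions. *)
Definition perm_swap (i : 'I_n.-1) (g : 'S_n) : 'S_n :=
  (g * tperm (entry i) (entry_succ i))%g.

Lemma tperm_entryE i (l : 'I_n) : tperm (entry i) (entry_succ i) l =
  (if l == i :> nat then i.+1 else if l == i.+1 :> nat then i : nat else l)
  :> nat.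
Proof.
by rewrite permE /= -!val_eqE /=; case: ifP => //; case: ifP.
Qed.

Lemma perm_swap_posE i (g : 'S_n) k :
  ((perm_swap i g)^-1)%g k = (g^-1)%g (tperm (entry i) (entry_succ i) k).
Proof. by rewrite invMg permM tpermV. Qed.

Lemma perm_swap_far (i j : 'I_n.-1) (g : 'S_n) :
  (i.+2 <= j)%N || (j.+2 <= i)%N ->
  perm_swap i (perm_swap j g) = perm_swap j (perm_swap i g).
Proof.
move=> ij; apply/permP => k; rewrite !permM; move: (g k) => l.
apply: val_inj; rewrite /= !tperm_entryE.
move: ij; clear; move: (l : nat) (i : nat) (j : nat) => {}l {}i {}j.
by do !case: eqP; lia.
Qed.

Lemma perm_swap_braid (i j : 'I_n.-1) (g : 'S_n) : j = i.+1 :> nat ->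
  perm_swap i (perm_swap j (perm_swap i g)) =
  perm_swap j (perm_swap i (perm_swap j g)).
Proof.
move=> ij; apply/permP => k; rewrite !permM; move: (g k) => l.
apply: val_inj; rewrite /= !tperm_entryE.
move: ij; clear; move: (l : nat) (i : nat) (j : nat) => {}l {}i {}j ->.
by do !case: eqP; lia.
Qed.

Lemma tperm_entry_far (i j : 'I_n.-1) :
  (i.+2 <= j)%N || (j.+2 <= i)%N ->
  (tperm (entry i) (entry_succ i) (entry j) = entry j) *
  (tperm (entry i) (entry_succ i) (entry_succ j) = entry_succ j).
Proof.
move=> ij; split; apply: val_inj; rewrite /= tperm_entryE /=;
  by do !case: eqP; lia.
Qed.

Lemma entry_next (i j : 'I_n.-1) : j = i.+1 :> nat -> entry j = entry_succ i.
Proof. by move=> ij; apply: val_inj. Qed.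

Lemma perm_swap_next (i j : 'I_n.-1) (g : 'S_n) : j = i.+1 :> nat ->
  let p := entry i in let q := entry_succ i in let r := entry_succ j in
  (((perm_swap i g)^-1)%g p = (g^-1)%g q) *
  (((perm_swap i g)^-1)%g q = (g^-1)%g p) *
  (((perm_swap i g)^-1)%g r = (g^-1)%g r) *
  (((perm_swap j g)^-1)%g p = (g^-1)%g p) *
  (((perm_swap j g)^-1)%g q = (g^-1)%g r) *
  (((perm_swap j g)^-1)%g r = (g^-1)%g q).
Proof.
move=> ij p q r; have jq : entry j = q by exact: entry_next.
have [np nq] : p != r /\ q != r.
  by rewrite -!val_eqE /= ij !neq_ltn !ltnS !leqnn leqnSn.
have npq : p != q by rewrite -val_eqE /= neq_ltn leqnn.
by rewrite !perm_swap_posE jq !tpermL !tpermR !tpermD // eq_sym.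
Qed.

Lemma perm_des_next (i j : 'I_n.-1) (g : 'S_n) : j = i.+1 :> nat ->
  let p := entry i in let q := entry_succ i in let r := entry_succ j in
  ((i \in perm_des g) = ((g^-1)%g q < (g^-1)%g p)%N) *
  ((j \in perm_des g) = ((g^-1)%g r < (g^-1)%g q)%N).
Proof. by move=> ij p q r; rewrite !inE (entry_next ij). Qed.

Definition lweak_cover : rel 'S_n := fun g d =>
  [exists i : 'I_n.-1, (i \notin perm_des g) && (d == perm_swap i g)].

Definition lweak_le : rel 'S_n := connect lweak_cover.

Definition lweak_interval (s r : 'S_n) : {set 'S_n} :=
  [set g | lweak_le s g && lweak_le g r].

End WeakOrder.

Section Span.
Variables (K : fieldType) (X : finType) (S : {set X}).

Definition span_of : Type := {ffun {x : X | x \in S} -> K^o}.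
HB.instance Definition _ := GRing.Lmodule.on span_of.

(* The basis vector of x if x \in S; by convention 0 if x \notin S. *)
Definition span_vec (x : X) : span_of := [ffun y => (val y == x)%:R].

Definition span_ext (b : X -> span_of) (v : span_of) : span_of :=
  \sum_(y : {x : X | x \in S}) v y *: b (val y).

Fact span_ext_linear b : linear (span_ext b).
Proof.
move=> a u v; rewrite /span_ext scaler_sumr -big_split /=.
by apply: eq_bigr => y _; rewrite !ffunE scalerDl scalerA.
Qed.

HB.instance Definition _ b :=
  GRing.isLinear.Build K span_of span_of _ (span_ext b) (span_ext_linear b).

Lemma span_vec_out x : x \notin S -> span_vec x = 0.
Proof.
move=> xS; apply/ffunP => y; rewrite !ffunE.
by case: eqP => // yx; move: xS; rewrite -yx (valP y).
Qed.

Lemma span_ext_vec b x : span_ext b (span_vec x) = if x \in S then b x else 0.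
Proof.
case: ifP => [xS|/negbT xS]; last by rewrite span_vec_out // linear0.
rewrite /span_ext (bigD1 (exist _ x xS)) //= ffunE /= eqxx scale1r.
rewrite big1 ?addr0 // => y yx; rewrite ffunE.
suff -> : (val y == x) = false by rewrite scale0r.
by apply: contraNF yx => /eqP yx; apply/eqP/val_inj.
Qed.

Lemma span_decomp (v : span_of) :
  v = \sum_(y : {x : X | x \in S}) v y *: span_vec (val y).
Proof.
have scE (a c : K) : a *: (c : K^o) = a * c by [].
apply/ffunP => z; rewrite sum_ffunE (bigD1 z) //= !ffunE eqxx scE mulr1.
rewrite big1 ?addr0 // => y yz; rewrite !ffunE.
suff -> : (val z == val y) = false by rewrite scE mulr0.
by apply: contraNF yz => /eqP/val_inj ->.
Qed.

Lemma eq_span_linear (f g : {linear span_of -> span_of}) :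
  (forall x, x \in S -> f (span_vec x) = g (span_vec x)) -> f =1 g.
Proof.
move=> fg v; rewrite (span_decomp v) !linear_sum; apply: eq_bigr => y _.
by rewrite !linearZ /= fg // (valP y).
Qed.

End Span.

Section SpanHecke.
Variables (K : fieldType) (n : nat) (X : finType) (S : {set X}).
Variables (w : X -> 'S_n) (s : 'I_n.-1 -> X -> X).
Hypothesis w_inj : injective w.
Hypothesis ws : forall i x, w (s i x) = perm_swap i (w x).

Let des i x := i \in perm_des (w x).
Let pos x (k : 'I_n) : 'I_n := ((w x)^-1)%g k.

Hypothesis diamond2 : forall (i j : 'I_n.-1) x,
  (i.+2 <= j)%N || (j.+2 <= i)%N -> x \in S -> ~~ des i x -> ~~ des j x ->
  s i x \in S -> s j (s i x) \in S -> s j x \in S.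

Hypothesis diamond3 : forall (i j : 'I_n.-1) x,
  (j = i.+1 :> nat \/ i = j.+1 :> nat) -> x \in S -> ~~ des i x -> ~~ des j x ->
  s i x \in S -> s j (s i x) \in S -> s i (s j (s i x)) \in S ->
  (s j x \in S) && (s i (s j x) \in S).

Variable b : 'I_n.-1 -> X -> span_of K S.
Hypothesis bE : forall i x, x \in S ->
  b i x = if des i x then - span_vec K S x else span_vec K S (s i x).

Local Notation op i := (span_ext (b i)).
Local Notation e := (span_vec K S).

Let opE i x : op i (e x) =
  if x \in S then if des i x then - e x else e (s i x) else 0.
Proof. by rewrite span_ext_vec; case: ifP => // xS; rewrite bE. Qed.

Let desE i x : des i x = (pos x (entry_succ i) < pos x (entry i))%N.
Proof. by rewrite /des inE. Qed.

Let posE i x k : pos (s i x) k = pos x (tperm (entry i) (entry_succ i) k).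
Proof. by rewrite /pos ws perm_swap_posE. Qed.

Let pos_inj x k l : (pos x k == pos x l :> nat) = (k == l :> nat).
Proof.
apply/eqP/eqP => [/val_inj/perm_inj-> //|/val_inj-> //].
Qed.

Let des_si i x : des i (s i x) = ~~ des i x.
Proof.
rewrite !desE !posE tpermL tpermR.
have := pos_inj x (entry i) (entry_succ i); rewrite /=; lia.
Qed.

Let des_far (i j : 'I_n.-1) x : (i.+2 <= j)%N || (j.+2 <= i)%N ->
  des j (s i x) = des j x.
Proof.
by move=> ij; rewrite !desE !posE !(tperm_entry_far ij).
Qed.

Let s_far (i j : 'I_n.-1) x : (i.+2 <= j)%N || (j.+2 <= i)%N ->
  s i (s j x) = s j (s i x).
Proof. by move=> ij; apply: w_inj; rewrite !ws; apply: perm_swap_far. Qed.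

Let s_braid (i j : 'I_n.-1) x : j = i.+1 :> nat ->
  s i (s j (s i x)) = s j (s i (s j x)).
Proof. by move=> ij; apply: w_inj; rewrite !ws; apply: perm_swap_braid. Qed.

Let opl i : {linear span_of K S -> span_of K S} := span_ext (b i).

Lemma span_hecke_relations :
  hecke_relations (fun i => span_ext (b i) : {linear span_of K S -> span_of K S}).
Proof.
split.
- move=> i v; apply: (@eq_span_linear _ _ _ (opl i \o opl i) (\- opl i)) => x xS.
  rewrite /= opE xS; case: ifP => dx; rewrite ?linearN /= opE ?xS ?dx //.
  by rewrite des_si dx /=; case: ifP => // /negbT sS; rewrite span_vec_out ?oppr0.
- move=> i j ij v.
  apply: (@eq_span_linear _ _ _ (opl i \o opl j) (opl j \o opl i)) => x xS /=.
  have ji : (j.+2 <= i)%N || (i.+2 <= j)%N by rewrite orbC.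
  rewrite !opE xS.
  have := @diamond2 i j x ij xS; have := @diamond2 j i x ji xS.
  have dij y : des j (s i y) = des j y by apply: des_far.
  have dji y : des i (s j y) = des i y by apply: des_far.
  rewrite !(s_far x ij).
  case di: (des i x); case dj: (des j x);
    do 3 ?rewrite ?(linearN, opE, xS, dij, dji, di, dj, s_far x ij) ?opprK //=.
  + by case: ifP => // /negbT sS; rewrite span_vec_out ?oppr0.
  + by case: ifP => // /negbT sS; rewrite span_vec_out ?oppr0.
  + move=> H1 H2.
    have [sS|sS] := boolP (s j (s i x) \in S); last by rewrite span_vec_out ?if_same.
    case: ifP => [sj|sj]; case: ifP => [si|si] //.
      by move: (H1 isT isT sj sS); rewrite si.
    by move: (H2 isT isT si sS); rewrite sj.
- move=> i j ij v.
  apply: (@eq_span_linear _ _ _ (opl i \o opl j \o opl i) (opl j \o opl i \o opl j)).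
  move=> x xS /=.
  have D3 := @diamond3 i j x (or_introl ij) xS.
  have D3' := @diamond3 j i x (or_intror ij) xS.
  pose p := entry i; pose q := entry_succ i; pose r := entry_succ j.
  have dE y : (des i y = (pos y q < pos y p)%N) * (des j y = (pos y r < pos y q)%N).
    exact: perm_des_next.
  have pE y : (pos (s i y) p = pos y q) * (pos (s i y) q = pos y p) *
    (pos (s i y) r = pos y r) * (pos (s j y) p = pos y p) *
    (pos (s j y) q = pos y r) * (pos (s j y) r = pos y q).
    by rewrite /pos !ws; apply: perm_swap_next.
  have d_ij : des j (s i x) = (pos x r < pos x p)%N by rewrite dE !pE.
  have d_ji : des i (s j x) = (pos x r < pos x p)%N by rewrite dE !pE.
  have d_iji : des i (s j (s i x)) = des j x by rewrite !dE !pE.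
  have d_jij : des j (s i (s j x)) = des i x by rewrite !dE !pE.
  have dAB : des i x -> des j x -> (pos x r < pos x p)%N.
    by rewrite !dE => A B; apply: ltn_trans B A.
  have dNAB : ~~ des i x -> ~~ des j x -> ~~ (pos x r < pos x p)%N.
    by rewrite !dE -!leqNgt => A B; apply: leq_trans A B.
  move: dAB dNAB d_ij d_ji; move: (_ < _)%N => c dAB dNAB d_ij d_ji.
  have sB := s_braid x ij.
  have opif k m u : op k (if m then u else 0) = if m then op k u else 0.
    by case: m => //; rewrite linear0.
  have nif m (u : span_of K S) : - (if m then u else 0) = if m then - u else 0.
    by case: m => //; rewrite oppr0.
  have eN y : y \notin S -> e y = 0 by apply: span_vec_out.
  case A: (des i x) dAB dNAB d_jij D3 D3';
    case B: (des j x) d_iji => d_iji dAB dNAB d_jij D3 D3';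
    case C: c d_ij d_ji dAB dNAB => d_ij d_ji dAB dNAB;
    do ?[by move: (dAB isT isT) | by move: (dNAB isT isT)];
    do 6 ?rewrite ?(opE, linearN, opif, nif, xS, A, B, d_ij, d_ji, d_iji,
      d_jij, des_si, sB, opprK) /=.
  + by [].
  + by case: (s j x \in S).
  + by case: ifP => // _; case: ifP => // /negbT/eN ->; rewrite oppr0.
  + by case: (s i x \in S).
  + by case: ifP => // _; case: ifP => // /negbT/eN ->; rewrite oppr0.
  + have [tS|/eN->] := boolP (s j (s i (s j x)) \in S); last by rewrite !if_same.
    move: D3 D3'; rewrite sB tS.
    case: (s i x \in S); case: (s j x \in S);
    case: (s j (s i x) \in S); case: (s i (s j x) \in S) => // D3 D3';
    by [move: (D3 isT isT isT isT isT) | move: (D3' isT isT isT isT isT)].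
Qed.

End SpanHecke.

Section WeakBruhatModule.
Variables (K : fieldType) (n : nat) (s r : 'S_n).
Local Notation I := (lweak_interval s r).

Definition weak_act (i : 'I_n.-1) (g : 'S_n) : span_of K I :=
  if i \in perm_des g then - span_vec K I g
  else if perm_swap i g \in I then span_vec K I (perm_swap i g)
  else 0.

Let lweak_swap i (g : 'S_n) : i \notin perm_des g ->
  lweak_le g (perm_swap i g).
Proof.
by move=> ig; apply: connect1; apply/existsP; exists i; rewrite ig eqxx.
Qed.

Let lweak_interval_mid (x y z : 'S_n) : x \in I -> z \in I ->
  lweak_le x y -> lweak_le y z -> y \in I.
Proof.
rewrite !inE => /andP[sx _] /andP[_ zr] xy yz.
by rewrite /lweak_le (connect_trans sx xy) (connect_trans yz zr).
Qed.

Lemma weak_act_relations :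
  hecke_relations
    (fun i => span_ext (weak_act i) : {linear span_of K I -> span_of K I}).
Proof.
apply: (@span_hecke_relations K n _ I id (@perm_swap n)) => //.
- move=> i j x ij xI id jd iI jI.
  apply: (lweak_interval_mid xI jI); first exact: lweak_swap.
  rewrite -perm_swap_far //; apply: lweak_swap.
  by move: id; rewrite !inE !perm_swap_posE !tperm_entry_far // orbC.
- move=> i j x ij xI id jd _ _ tI.
  have tE : perm_swap i (perm_swap j (perm_swap i x)) =
            perm_swap j (perm_swap i (perm_swap j x)).
    by case: ij => ij; [|symmetry]; apply: perm_swap_braid.
  rewrite tE in tI.
  have [ij2 ij3] : i \notin perm_des (perm_swap j x) /\
    j \notin perm_des (perm_swap i (perm_swap j x)).
    move: id jd; case: ij => ij.
      rewrite !(perm_des_next _ ij) !(perm_swap_next _ ij) -!leqNgt.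
      by move=> A B; split=> //; apply: leq_trans A B.
    rewrite !(perm_des_next _ ij) !(perm_swap_next _ ij) -!leqNgt.
    by move=> A B; split=> //; apply: leq_trans B A.
  have A := lweak_swap jd; have B := lweak_swap ij2; have C := lweak_swap ij3.
  apply/andP; split; apply: (lweak_interval_mid xI tI) => //.
    exact: connect_trans B C.
  exact: connect_trans A B.
- move=> i x xI; rewrite /weak_act; case: ifP => // _.
  by case: ifP => // /negbT sI; rewrite span_vec_out.
Qed.

Definition weak_bruhat_module : lmodType (hecke0 K n) :=
  hecke_module weak_act_relations.

End WeakBruhatModule.

(* Only the boxes of a diagram and the reading order on them matter. *)
Record diagram (n : nat) := Diagram {
  diag_box :> finType;
  diag_card : #|diag_box| = n;
  reading_le : rel diag_box;
  reading_anti : antisymmetric reading_le;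
  reading_trans : transitive reading_le;
  reading_total : total reading_le }.

Section Fillings.
Variables (n : nat) (D : diagram n).

Fact size_reading_seq : size (sort (@reading_le n D) (enum D)) == n.
Proof. by rewrite size_sort -cardE diag_card. Qed.

Definition reading_seq : n.-tuple D := Tuple size_reading_seq.

Lemma mem_reading_seq b : b \in reading_seq.
Proof. by rewrite mem_sort mem_enum. Qed.

Lemma reading_seq_inj : injective (tnth reading_seq).
Proof. by apply/tuple_uniqP; rewrite sort_uniq enum_uniq. Qed.

(* D has n boxes, so injectivity means bijectivity. *)
Definition std_fill : Type := {T : {ffun D -> 'I_n} | injectiveb T}.
HB.instance Definition _ := Finite.on std_fill.

Lemma std_fill_inj (T : std_fill) : injective (val T).
Proof. by apply/injectiveP; apply: (valP T). Qed.

Fact rw_subproof (T : std_fill) :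
  injective (fun k : 'I_n => val T (tnth reading_seq k)).
Proof. by move=> k l /std_fill_inj/reading_seq_inj. Qed.

Definition rw (T : std_fill) : 'S_n := perm (@rw_subproof T).

Fact fill_swap_subproof (i : 'I_n.-1) (T : std_fill) :
  injectiveb [ffun b => tperm (entry i) (entry_succ i) (val T b)].
Proof.
by apply/injectiveP => b c; rewrite !ffunE => /perm_inj/std_fill_inj.
Qed.

Definition fill_swap (i : 'I_n.-1) (T : std_fill) : std_fill :=
  exist (fun U : {ffun D -> 'I_n} => injectiveb U) _ (fill_swap_subproof i T).

Definition fill_des (T : std_fill) : {set 'I_n.-1} := perm_des (rw T).

Lemma rw_inj : injective rw.
Proof.
move=> T U TU; apply: val_inj; apply/ffunP => b.
have /tnthP[k ->] := mem_reading_seq b.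
by have := congr1 (fun g : 'S_n => g k) TU; rewrite !permE.
Qed.

Lemma rw_swap i T : rw (fill_swap i T) = perm_swap i (rw T).
Proof. by apply/permP => k; rewrite permM !permE /= ffunE permE. Qed.

Variable StdTab : {set std_fill}.

Definition attacking (T : std_fill) (i : 'I_n.-1) : bool :=
  (i \notin fill_des T) && (fill_swap i T \notin StdTab).

Definition ascent_at (T : std_fill) (r s : 'I_n) : bool :=
  (r < s)%N && (rw T s == (rw T r).+1 :> nat).

(* An ascent of T in positions (r, s) is the ascent i of T with i = rw(T)_r. *)
Definition ascent_compatible : Prop :=
  forall (T T' : std_fill) (r s : 'I_n) (i i' : 'I_n.-1),
    T \in StdTab -> T' \in StdTab -> ascent_at T r s -> ascent_at T' r s ->
    i = rw T r :> nat -> i' = rw T' r :> nat ->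
    attacking T i = attacking T' i'.

Variable K : fieldType.

Definition tab_act (i : 'I_n.-1) (T : std_fill) : span_of K StdTab :=
  if i \in fill_des T then - span_vec K StdTab T
  else if attacking T i then 0
  else span_vec K StdTab (fill_swap i T).

Hypothesis compat : ascent_compatible.

Let step T T' i i' : T \in StdTab -> T' \in StdTab -> i \notin fill_des T ->
  ((rw T)^-1 (entry i) = (rw T')^-1 (entry i'))%g ->
  ((rw T)^-1 (entry_succ i) = (rw T')^-1 (entry_succ i'))%g ->
  fill_swap i T \in StdTab -> fill_swap i' T' \in StdTab.
Proof.
move=> TS TS' id e1 e2 iT.
have id' : i' \notin fill_des T' by move: id; rewrite !inE e1 e2.
have lt : ((rw T)^-1 (entry i) < (rw T)^-1 (entry_succ i))%g%N.
  move: id; rewrite !inE -leqNgt leq_eqVlt => /orP[/eqP/val_inj/perm_inj|//].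
  by move/(congr1 val) => /=; lia.
move: lt; set p := ((rw T)^-1 (entry i))%g; set q := ((rw T)^-1 _)%g => lt.
have Tp : rw T p = entry i by rewrite permKV.
have Tq : rw T q = entry_succ i by rewrite permKV.
have T'p : rw T' p = entry i' by rewrite /p e1 permKV.
have T'q : rw T' q = entry_succ i' by rewrite /q e2 permKV.
have := @compat T T' p q i i' TS TS'; rewrite /ascent_at /attacking id id' iT.
rewrite lt Tp Tq T'p T'q /= !eqxx => H.
by have /esym/negbFE := H isT isT erefl erefl.
Qed.

Lemma tab_act_relations :
  hecke_relations (fun i => span_ext (tab_act i)
    : {linear span_of K StdTab -> span_of K StdTab}).
Proof.
apply: (@span_hecke_relations K n _ StdTab rw fill_swap) => //.
- exact: rw_inj.
- exact: rw_swap.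
- move=> i j T ij TS id jd iS jS.
  apply: (step iS TS _ _ _ jS); rewrite /fill_des ?inE rw_swap
    !perm_swap_posE !(tperm_entry_far ij) //.
  by move: jd; rewrite inE.
- move=> i j T ij TS id jd iS jS tS.
  case: ij => ij.
    have jT : fill_swap j T \in StdTab.
      apply: (step jS TS _ _ _ tS) => //;
      rewrite /fill_des ?(perm_des_next _ ij) ?(entry_next ij) !rw_swap
        !(perm_swap_next _ ij) //.
      by move: jd; rewrite (perm_des_next _ ij).
    rewrite jT /=; apply: (step iS jT _ _ _ jS) => //;
    rewrite /fill_des ?(perm_des_next _ ij) ?(entry_next ij) !rw_swap
        !(perm_swap_next _ ij) //.
    move: id jd; rewrite !(perm_des_next _ ij) -!leqNgt; exact: leq_trans.
  have jT : fill_swap j T \in StdTab.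
    apply: (step jS TS _ _ _ tS) => //;
    rewrite /fill_des ?(perm_des_next _ ij) ?(entry_next ij) !rw_swap
        !(perm_swap_next _ ij) //.
    by move: jd; rewrite (perm_des_next _ ij).
  rewrite jT /=; apply: (step iS jT _ _ _ jS) => //;
  rewrite /fill_des ?(perm_des_next _ ij) ?(entry_next ij) !rw_swap
        !(perm_swap_next _ ij) //.
  move: id jd; rewrite !(perm_des_next _ ij) -!leqNgt => A B; exact: leq_trans B A.
- move=> i T TS; rewrite /tab_act /attacking /fill_des.
  case: (i \in perm_des (rw T)) => //=.
  by case: ifP => // sS; rewrite span_vec_out.
Qed.

Definition tab_module : lmodType (hecke0 K n) := hecke_module tab_act_relations.

End Fillings.

(* Main.v *)
(** Left weak order is containment of inversion sets, an inversion of [g] being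
    a pair of positions.  If [i] is an ascent of [g], with the entries [i] and
    [i + 1] in positions [p] and [q], then [s_i g] has exactly one inversion
    more than [g], namely [(p, q)].  So for [g] in the interval, [s_i g] stays
    in it iff [(p, q)] is an inversion of the upper bound, a condition on the
    positions alone: this is ascent-compatibility.  The isomorphism is then the
    relabelling of basis vectors along [rw]. *)
Require Import Defs.
From HB Require Import structures.
From mathcomp Require Import all_boot all_order all_fingroup all_algebra.
From mathcomp Require Import reals complex zify.

Set Implicit Arguments.
Unset Strict Implicit.
Unset Printing Implicit Defensive.

Import GRing.Theory.
Local Open Scope ring_scope.

(** * Inversion sets and left weak order *)

(** Upward induction from [0] gives [a <= h a], and downward induction from [n.-1] gives
    [h a <= a]. *)
Lemma lt_succ_id n (h : 'I_n -> 'I_n) :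
  (forall i : 'I_n.-1, (h (entry i) < h (entry_succ i))%N) -> h =1 id.
Proof.
move=> hS.
have step (a b : 'I_n) : b = a.+1 :> nat -> (h a < h b)%N.
  move=> ab; have lt : (a < n.-1)%N by have := ltn_ord b; lia.
  have -> : a = entry (Ordinal lt) by apply: val_inj.
  by have -> : b = entry_succ (Ordinal lt) by apply: val_inj.
have ge m (a : 'I_n) : a = m :> nat -> (a <= h a)%N.
  elim: m a => [|m IH] a am; first by lia.
  have lt : (m < n)%N by have := ltn_ord a; lia.
  by have := IH (Ordinal lt) erefl; have := step (Ordinal lt) a am => /=; lia.
have le m (a : 'I_n) : (a + m = n.-1)%N -> (h a <= a)%N.
  elim: m a => [|m IH] a am; first by have := ltn_ord (h a); lia.
  have lt : (a.+1 < n)%N by lia.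
  by have := IH (Ordinal lt); have := step a (Ordinal lt) erefl => /=; lia.
move=> a; apply: val_inj => /=; have := ge a a erefl.
by have := le (n.-1 - a)%N a; have := ltn_ord a; lia.
Qed.

Section Inversions.
Variable n : nat.
Implicit Types g d : 'S_n.

Definition perm_inv g : {set 'I_n * 'I_n} :=
  [set ab : 'I_n * 'I_n | (ab.1 < ab.2)%N && (g ab.2 < g ab.1)%N].

(** Any other value compares alike with two consecutive values, so exchanging them only affects the
    pair of positions that hold them. *)
Lemma perm_inv_swap i g : i \notin perm_des g ->
  perm_inv (perm_swap i g) =
  ((g^-1)%g (entry i), (g^-1)%g (entry_succ i)) |: perm_inv g.
Proof.
rewrite inE -leqNgt => pq; apply/setP => -[a b].
rewrite !inE /= xpair_eqE !permM !tperm_entryE.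
have E k c : (c == (g^-1)%g k) = (g c == k :> nat).
  by rewrite -(inj_eq (@perm_inj _ g)) permKV.
have gab : (g a == g b :> nat) = (a == b :> nat).
  exact: (inj_eq (@perm_inj _ g)).
(* The ascent hypothesis is used only through [contra] and [pq']; with these, the goal is arithmetic
   in [g a], [g b] and [i]. *)
have contra : (g b = i :> nat) -> (g a = i.+1 :> nat) -> ~ (a < b)%N.
  move=> /eqP; rewrite -[nat_of_ord i]/(nat_of_ord (entry i)) -E => /eqP->.
  move=> /eqP; rewrite -[i.+1]/(nat_of_ord (entry_succ i)) -E => /eqP->.
  by lia.
have pq' : (g a = i :> nat) -> (g b = i.+1 :> nat) -> (a < b)%N.
  move=> ga /[dup] gb /eqP.
  rewrite -[i.+1]/(nat_of_ord (entry_succ i)) -E => /eqP->.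
  move/eqP: (ga); rewrite -[nat_of_ord i]/(nat_of_ord (entry i)) -E => /eqP aE.
  rewrite aE ltn_neqAle pq andbT.
  apply/eqP => /val_inj/perm_inj/(congr1 val) /=; lia.
rewrite !E /=; move: contra pq' gab; clear.
move: (g a : nat) (g b : nat) (i : nat) => ga gb m.
by do !case: eqP; lia.
Qed.

Lemma lweak_le_inv g d : lweak_le g d -> perm_inv g \subset perm_inv d.
Proof.
move=> /connectP[p]; elim: p g => [|x p IH] g /=; first by move=> _ ->.
move=> /andP[/existsP[i /andP[id /eqP xE]] px] dE.
apply: subset_trans (IH x px dE).
by rewrite xE perm_inv_swap // subsetU1.
Qed.

(* If every ascent of g is an ascent of d at the same positions, then d g^-1 is
   increasing on consecutive entries, so it is the identity. *)
Lemma inv_lweak_le g d : perm_inv g \subset perm_inv d -> lweak_le g d.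
Proof.
(* Induction on the number of inversions of [d] missing from [g]: swapping an ascent of [g] that [d]
   inverts gains one of them. *)
have [m] := ubnP #|perm_inv d :\: perm_inv g|.
elim: m g => // m IH g leqm gd.
have [/existsP[i /andP[id pqd]]|/existsPn noasc] :=
  boolP [exists i, (i \notin perm_des g) &&
    (((g^-1)%g (entry i), (g^-1)%g (entry_succ i)) \in perm_inv d)].
  apply: (connect_trans (y := perm_swap i g)).
    by apply: connect1; apply/existsP; exists i; rewrite id eqxx.
  apply: IH; last by rewrite perm_inv_swap // subUset sub1set pqd.
  rewrite -ltnS; apply: leq_trans leqm; rewrite ltnS; apply: proper_card.
  rewrite perm_inv_swap //; apply/properP; split.
    by apply: setDS; apply: subsetU1.
  exists ((g^-1)%g (entry i), (g^-1)%g (entry_succ i)).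
    rewrite in_setD pqd andbT inE /= !permKV /=.
    by rewrite [(_.+1 < _)%N]ltnNge leqnSn andbF.
  by rewrite in_setD in_setU1 eqxx.
suff -> : d = g by apply: connect0.
have /lt_succ_id h : forall i : 'I_n.-1,
    ((g^-1 * d)%g (entry i) < (g^-1 * d)%g (entry_succ i))%N.
  move=> i; rewrite !permM.
  have neq : entry i != entry_succ i by rewrite -val_eqE /= neq_ltn leqnn.
  (* A descent of [g] is inverted in [d] by containment; an ascent is not, by [noasc]. *)
  have [id|id] := boolP (i \in perm_des g).
    have /(subsetP gd) :
        ((g^-1)%g (entry_succ i), (g^-1)%g (entry i)) \in perm_inv g.
      by move: id; rewrite !inE /= !permKV /= ltnSn andbT.
    by rewrite inE => /andP[].
  have := noasc i; rewrite id /= inE negb_and /=.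
  have := id; rewrite inE -leqNgt leq_eqVlt => /orP[/eqP/val_inj/perm_inj|->].
    by move/eqP; rewrite (negPf neq).
  rewrite /= -leqNgt leq_eqVlt => /orP[/eqP/val_inj/perm_inj/perm_inj/eqP|//].
  by rewrite (negPf neq).
apply/permP => k; have := h (g k).
by rewrite permM permK.
Qed.

Lemma lweak_leE g d : lweak_le g d = (perm_inv g \subset perm_inv d).
Proof. by apply/idP/idP; [apply: lweak_le_inv | apply: inv_lweak_le]. Qed.

(** The swap only adds an inversion, so the lower bound persists and the upper bound can fail only
    at the new pair. *)
Lemma perm_swap_interval s r i g : g \in lweak_interval s r ->
  i \notin perm_des g ->
  (perm_swap i g \in lweak_interval s r) =
  (((g^-1)%g (entry i), (g^-1)%g (entry_succ i)) \in perm_inv r).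
Proof.
rewrite ![_ \in lweak_interval _ _]in_set !lweak_leE => /andP[sg gr] id.
rewrite perm_inv_swap // subUset sub1set gr andbT.
by rewrite (subset_trans sg (subsetU1 _ _)).
Qed.

End Inversions.

(** * Relabelling of bases and module isomorphisms *)

Lemma span_linear_ext (K : fieldType) (X : finType) (S : {set X})
    (V : lmodType K) (f g : {linear span_of K S -> V}) :
  (forall x, x \in S -> f (span_vec K S x) = g (span_vec K S x)) -> f =1 g.
Proof.
move=> fg v; rewrite (span_decomp v) !linear_sum; apply: eq_bigr => y _.
by rewrite !linearZ /= fg // (valP y).
Qed.

Section SpanPull.
Variables (K : fieldType) (X Y : finType) (S : {set X}) (S' : {set Y}).
Variable w : X -> Y.
Hypothesis w_inj : injective w.
Hypothesis wS : [set w x | x in S] = S'.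

Fact span_pull_subproof (x : {x : X | x \in S}) : w (val x) \in S'.
Proof. by rewrite -wS imset_f ?(valP x). Qed.

(** Vectors are coordinate functions, so relabelling is precomposition with [w], which requires no
    inverse of [w]. *)
Definition span_pull (v : span_of K S') : span_of K S :=
  [ffun x => v (exist _ (w (val x)) (span_pull_subproof x))].

Fact span_pull_linear : linear span_pull.
Proof. by move=> a u v; apply/ffunP => x; rewrite !ffunE. Qed.

HB.instance Definition _ :=
  GRing.isLinear.Build K (span_of K S') (span_of K S) _ span_pull
    span_pull_linear.

Lemma span_pull_vec x : span_pull (span_vec K S' (w x)) = span_vec K S x.
Proof. by apply/ffunP => y; rewrite !ffunE /= (inj_eq w_inj). Qed.

Lemma span_pull_bij : bijective span_pull.
Proof.
pose push (v : span_of K S) : span_of K S' :=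
  \sum_(x : {x : X | x \in S}) v x *: span_vec K S' (w (val x)).
have pushK : cancel push span_pull.
  move=> v; rewrite [RHS]span_decomp linear_sum; apply: eq_bigr => x _.
  by rewrite linearZ /= span_pull_vec.
(* Here [w] being onto [S'] matters: it makes every coordinate of a vector visible after pulling
   back. *)
have pull_inj : injective span_pull.
  move=> u v uv; apply/ffunP => -[y yS'].
  have /imsetP[x xS yE] : y \in [set w x | x in S] by rewrite wS.
  have := congr1 (fun f : span_of K S => f (exist _ x xS)) uv; rewrite !ffunE.
  have -> // : exist _ (w (val (exist (fun x => x \in S) x xS)))
                 (span_pull_subproof _) = exist (fun y => y \in S') y yS'.
  exact: val_inj.
exact: Bijective (inj_can_sym pushK pull_inj) pushK.
Qed.

End SpanPull.

(** Commuting with the generators extends to every formal expression by structural induction, hence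
    to the whole algebra. *)
Lemma hecke_module_iso (K : fieldType) (n : nat) (V W : lmodType K)
    (f : 'I_n.-1 -> {linear V -> V}) (g : 'I_n.-1 -> {linear W -> W})
    (f_rel : hecke_relations f) (g_rel : hecke_relations g)
    (phi : {linear V -> W}) :
  bijective phi -> (forall i v, phi (f i v) = g i (phi v)) ->
  module_isomorphic (hecke_module f_rel) (hecke_module g_rel).
Proof.
move=> phi_bij phi_fg.
have phi_eval t v : phi (hecke_eval f t v) = hecke_eval g t (phi v).
  elim: t v => [i|||t IHt u IHu|a t IHt|t IHt u IHu] v //=.
  - exact: linear0.
  - by rewrite linearD IHt IHu.
  - by rewrite linearZ /= IHt.
  - by rewrite IHt IHu.
(* The additive groups are unchanged but the scalars now come from the algebra, so linearity has to
   be proved anew. *)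
pose psi : hecke_module f_rel -> hecke_module g_rel := phi.
have psi_lin : linear psi.
  move=> h u v; rewrite /psi.
  have -> : phi (h *: u + v) = phi (@hecke_act _ _ _ _ f_rel h u) + phi v.
    exact: (linearD phi).
  by rewrite /hecke_act phi_eval.
pose L := GRing.isLinear.Build _ (hecke_module f_rel) (hecke_module g_rel) _
  psi psi_lin.
pose Psi : {linear hecke_module f_rel -> hecke_module g_rel} :=
  HB.pack psi L.
by exists Psi.
Qed.

(** * Tableaux whose reading words form an interval *)

Section IntervalTableaux.
Variables (n : nat) (sigma rho : 'S_n) (D : diagram n).
Variable StdTab : {set std_fill D}.
Hypothesis rw_StdTab : [set rw T | T in StdTab] = lweak_interval sigma rho.

Lemma rw_interval T : (rw T \in lweak_interval sigma rho) = (T \in StdTab).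
Proof. by rewrite -rw_StdTab mem_imset //; apply: rw_inj. Qed.

Lemma attacking_interval T i :
  attacking StdTab T i =
  (i \notin perm_des (rw T)) &&
  (perm_swap i (rw T) \notin lweak_interval sigma rho).
Proof. by rewrite /attacking -rw_interval rw_swap. Qed.

Lemma interval_ascent_compatible : ascent_compatible StdTab.
Proof.
(* The right-hand side depends on the positions and [rho] but not on [T], which is what
   compatibility asks. *)
have attE T r s (i : 'I_n.-1) : T \in StdTab -> ascent_at T r s ->
    i = rw T r :> nat -> attacking StdTab T i = ((r, s) \notin perm_inv rho).
  move=> TS /andP[rs /eqP rwS] iE.
  have rE : (rw T)^-1%g (entry i) = r.
    by apply: (@perm_inj _ (rw T)); rewrite permKV; apply: val_inj.
  have sE : (rw T)^-1%g (entry_succ i) = s.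
    apply: (@perm_inj _ (rw T)); rewrite permKV; apply: val_inj.
    by rewrite /= rwS iE.
  have id : i \notin perm_des (rw T) by rewrite inE rE sE -leqNgt ltnW.
  by rewrite attacking_interval id perm_swap_interval ?rE ?sE ?rw_interval.
move=> T T' r s i i' TS T'S rsT rsT' iE iE'.
by rewrite (attE T r s) // (attE T' r s).
Qed.

Lemma interval_module_iso (K : fieldType) (compat : ascent_compatible StdTab) :
  module_isomorphic (weak_bruhat_module K sigma rho) (tab_module K compat).
Proof.
pose phi : {linear span_of K (lweak_interval sigma rho) -> span_of K StdTab} :=
  span_pull rw_StdTab.
apply: (@hecke_module_iso _ _ _ _ _ _ _ _ phi).
  exact: span_pull_bij (@rw_inj _ D) rw_StdTab.
move=> i.
pose opW : {linear span_of K (lweak_interval sigma rho) ->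
  span_of K (lweak_interval sigma rho)} := span_ext (@weak_act K n sigma rho i).
pose opT : {linear span_of K StdTab -> span_of K StdTab} :=
  span_ext (tab_act StdTab K i).
(* It suffices to compare both sides on basis vectors, each of which is that of some [rw T]. *)
apply: (@span_linear_ext _ _ _ _ (phi \o opW) (opT \o phi)) => x.
rewrite -{1}rw_StdTab => /imsetP[T TS ->] /=.
have vecE U : phi (span_vec _ _ (rw U)) = span_vec _ _ U.
  exact: span_pull_vec (@rw_inj _ D) rw_StdTab U.
rewrite vecE /opW /opT /= !span_ext_vec rw_interval TS.
rewrite /weak_act /tab_act attacking_interval /fill_des.
case: ifP => [_|_]; first by rewrite linearN vecE.
rewrite -rw_swap /=; case: ifP => _ /=; first by rewrite vecE.
exact: linear0.
Qed.

End IntervalTableaux.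

Theorem theorem7p12 (R : realType) (n : nat) (sigma rho : 'S_n)
    (le_sigma_rho : lweak_le sigma rho)
    (D : diagram n) (StdTab : {set std_fill D})
    (rw_StdTab : [set rw T | T in StdTab] = lweak_interval sigma rho) :
  exists compat : ascent_compatible StdTab,
    module_isomorphic (weak_bruhat_module R[i] sigma rho)
                      (tab_module R[i] compat).
Proof.
exists (interval_ascent_compatible rw_StdTab).
exact: interval_module_iso.
Qed.
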